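(* $\mathrm{sc}(\{f\in\mathbb{R}^{\mathbb{R}}: f \text{ is bounded}\})=\omega_1$.
   Context: $\mathbb{R}^{\mathbb{R}}$ is the set of all functions $f:\mathbb{R}\to\mathbb{R}$. A difference operator is a map $D:\mathbb{R}^{\mathbb{R}}\to\mathbb{R}^{\mathbb{R}}$ of the form $(Df)(x)=\sum_{i=1}^n a_i f(x+b_i)$ with $a_i,b_i\in\mathbb{R}$; $\mathcal{D}$ is the set of difference operators. A system of difference equations is a set $S\subset\mathcal{D}\times\mathbb{R}^{\mathbb{R}}$; a function $f:\mathbb{R}\to\mathbb{R}$ is a solution to $S$ if $Df=g$ for every $(D,g)\in S$. A subsystem of $S$ is a subset of $S$. For $\mathcal{F}\subset\mathbb{R}^{\mathbb{R}}$ the solvability cardinal $\mathrm{sc}(\mathcal{F})$ is the minimal cardinal $\kappa$ with the following property: for every system $S$ of difference equations, if every subsystem of $S$ of cardinality less than $\kappa$ has a solution in $\mathcal{F}$, then $S$ has a solution in $\mathcal{F}$. *)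

(* Defs.v *)
From HB Require Import structures.
From mathcomp Require Import all_boot all_order all_algebra.
From mathcomp Require Import all_classical all_reals all_analysis.
From mathcomp Require Import wochoice.
Import Order.TTheory GRing.Theory Num.Theory.
Import numFieldNormedType.Exports.

Set Implicit Arguments.
Unset Strict Implicit.
Unset Printing Implicit Defensive.

Local Open Scope classical_set_scope.
Local Open Scope ring_scope.

(* A cardinal is represented by any set having that cardinality, in any type;
   two such sets represent the same cardinal when they are equinumerous. *)

Definition card_lt (T U : Type) (A : set T) (B : set U) : Prop :=
  (A #<= B)%card /\ ~ (A #= B)%card.

(* |K| is the minimal cardinal with the property P.  By Cantor-Bernstein, this
   determines K up to equinumerosity. *)
Definition is_least_cardinal (P : forall T : Type, set T -> Prop)
    (T : Type) (K : set T) : Prop :=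
  P T K /\ forall (U : Type) (L : set U), P U L -> (K #<= L)%card.

Definition uncountable (T : Type) (A : set T) : Prop := ~ countable A.

Lemma card_le_uncountable (T : Type) (lt : T -> T -> Prop) (K : set T)
    (lt_wf : well_founded lt)
    (lt_total : forall x y, x <> y -> lt x y \/ lt y x)
    (segment_countable : forall x, K x -> countable [set y | K y /\ lt y x])
    (U : Type) (L : set U) :
  uncountable L -> (K #<= L)%card.
Proof.
move=> Lunc.
have [u0 _] : exists u, L u.
  apply: contrapT => L0; apply: Lunc.
  suff -> : L = set0 by exact: countable0.
  by apply/seteqP; split=> // u Lu; case: L0; exists u.
pose pick (Q : set U) : U :=
  if pselect (exists z, Q z) is left e then projT1 (cid e) else u0.
have pickP Q : (exists z, Q z) -> Q (pick Q).
  by rewrite /pick; case: pselect => // e _; case: (cid e).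
pose fresh x (f : forall y, lt y x -> U) : U :=
  pick [set z | L z /\ forall y (h : lt y x), K y -> z <> f y h].
pose f := Fix lt_wf (fun=> U) fresh.
have fE x : f x = fresh x (fun y _ => f y).
  rewrite /f Fix_eq // => y g g' gg'; congr fresh.
  by apply: functional_extensionality_dep => z; apply: funext => h.
have fP x : K x -> L (f x) /\ forall y, lt y x -> K y -> f x <> f y.
  move=> Kx; rewrite [f x]fE.
  suff [z hz] : exists z, L z /\ forall y, lt y x -> K y -> z <> f y.
    by apply: (pickP [set z | L z /\ forall y, lt y x -> K y -> z <> f y]);
       exists z.
  apply: contrapT => nz; apply: Lunc.
  apply: (@sub_countable _ _ L [set y | K y /\ lt y x] _
    (segment_countable x Kx)).
  apply: card_le_trans (card_image_le f _).
  apply: subset_card_le => z Lz; apply: contrapT => zf; apply: nz; exists z.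
  by split=> // y yx Ky zE; apply: zf; exists y.
have fun_f : set_fun K L f by move=> x /fP[].
have inj_f : {in K &, injective f}.
  move=> x y /set_mem Kx /set_mem Ky fxy; apply: contrapT => /lt_total[xy|yx].
    by have [_ /(_ x xy Kx)] := fP y Ky; rewrite fxy.
  by have [_ /(_ y yx Ky)] := fP x Kx; rewrite fxy.
apply: (@card_le_trans _ _ _ (f @` K)); last first.
  by apply: subset_card_le => _ [x Kx <-]; exact: fun_f.
by rewrite (card_le_eqr (inj_card_eq inj_f)).
Qed.

Lemma uncountable_set_nat : uncountable [set: set nat].
Proof.
move=> /countable_injP[f f_inj].
pose D : set nat := [set n | exists2 A : set nat, f A = n & ~ A n].
have DE : D (f D) <-> ~ D (f D).
  split=> [[A fA nA]|nD]; last by exists D.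
  by move: nA; rewrite (f_inj A D) ?inE.
have nD : ~ D (f D) by move=> h; exact: (DE.1 h) h.
exact: nD (DE.2 nD).
Qed.

Lemma omega1_exists : exists K : set (set nat), is_least_cardinal uncountable K.
Proof.
have [R R_wo] := well_ordering_principle (set nat).
have minR (A : set (set nat)) : A !=set0 ->
    exists2 z, A z & forall x, A x -> R z x.
  move=> [a Aa].
  have [|z [[Az zle] _]] := R_wo [pred x | x \in A].
    by exists a; exact: mem_set.
  exists z => [|x Ax]; first exact: set_mem.
  by apply: zle; exact: mem_set.
pose lt x y := ~ R y x.
have lt_wf : well_founded lt.
  move=> x; apply: contrapT => nx.
  have [|z nz zmin] := minR [set x | ~ Acc lt x]; first by exists x.
  apply: nz; constructor=> y yz; apply: contrapT => /zmin zy; exact: yz.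
have lt_total x y : x <> y -> lt x y \/ lt y x.
  move=> xy; apply: contrapT => /not_orP[/contrapT Ryx /contrapT Rxy].
  have rR z : R z z.
    by have [|w -> /(_ z erefl)//] := minR [set z]; exists z.
  apply: xy; have [|w [_ wU]] := R_wo [pred z | (z == x) || (z == y)].
    by exists x; rewrite inE eqxx.
  have hx : minimum_of R [pred z | (z == x) || (z == y)] x.
    by split=> [|z]; rewrite inE ?eqxx// => /orP[]/eqP->.
  have hy : minimum_of R [pred z | (z == x) || (z == y)] y.
    by split=> [|z]; rewrite inE ?eqxx ?orbT// => /orP[]/eqP->.
  by rewrite -(wU _ hx) -(wU _ hy).
have [allc|] := pselect (forall x, countable [set y | lt y x]).
  exists setT; split=> [|U L]; first exact: uncountable_set_nat.
  apply: (card_le_uncountable lt_wf lt_total) => x _.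
  by apply: sub_countable (allc x); apply: subset_card_le => y [].
move=> /existsNP nc.
have [x xunc xmin] := minR [set x | uncountable [set y | lt y x]] nc.
exists [set y | lt y x]; split=> // U L.
apply: (card_le_uncountable lt_wf lt_total) => y yx.
have : countable [set z | lt z y] by apply: contrapT => /xmin; exact: yx.
by apply: sub_countable; apply: subset_card_le => z [].
Qed.

(* A set of cardinality omega_1, the least uncountable cardinal; which one is
   immaterial, since only its cardinality is used. *)
Definition omega1 : set (set nat) := projT1 (cid omega1_exists).

Lemma omega1P : is_least_cardinal uncountable omega1.
Proof. exact: projT2 (cid omega1_exists). Qed.

Definition is_difference_operator (R : realType) (D : (R -> R) -> (R -> R)) :
    Prop :=
  exists (n : nat) (a b : 'I_n -> R),
    forall (f : R -> R) (x : R), D f x = \sum_(i < n) a i * f (x + b i).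

(* The pair (D, g) stands for the equation D f = g. *)
Definition is_difference_system (R : realType)
    (S : set (((R -> R) -> (R -> R)) * (R -> R))) : Prop :=
  forall D g, S (D, g) -> is_difference_operator D.

Definition is_solution (R : realType)
    (S : set (((R -> R) -> (R -> R)) * (R -> R))) (f : R -> R) : Prop :=
  forall D g, S (D, g) -> D f = g.

Definition has_solution_in (R : realType) (F : set (R -> R))
    (S : set (((R -> R) -> (R -> R)) * (R -> R))) : Prop :=
  exists2 f, F f & is_solution S f.

(* The property of the cardinal |K| whose least instance is sc(F). *)
Definition solvability_property (R : realType) (F : set (R -> R))
    (T : Type) (K : set T) : Prop :=
  forall S, is_difference_system S ->
    (forall S', S' `<=` S -> card_lt S' K -> has_solution_in F S') ->
    has_solution_in F S.

(* sc(F) = |K| *)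
Definition is_solvability_cardinal (R : realType) (F : set (R -> R))
    (T : Type) (K : set T) : Prop :=
  is_least_cardinal (solvability_property F) K.

(* Main.v *)
Require Import Defs.
From mathcomp Require Import all_boot all_order all_algebra.
From mathcomp Require Import all_classical all_reals all_analysis.
Import Order.TTheory GRing.Theory Num.Theory.
Import numFieldNormedType.Exports.

(** Why the solvability cardinal of the bounded functions is omega_1.

    Upper bound: let every countable subsystem of [S] have a bounded solution.
    Some natural number [N] bounds a solution of each of them
    ([uniform_bound]): otherwise choose, for every [N], a countable subsystem
    without a solution bounded by [N]; the union of these is still countable,
    and a bounded solution of it contradicts one of the choices.  Functions
    with values in [-N, N] form a compact space for pointwise convergence, and
    the solutions of one difference equation form a closed set, since a
    difference operator only looks at finitely many values of [f] to compute
    one value of [D f].  So solutions bounded by [N] of the finite subsystems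
    accumulate at a solution of [S] ([compactness]).

    Lower bound: it suffices to exhibit an unsolvable system all of whose
    finite subsystems are solvable, because a set of cardinality less than a
    countable one is finite.  Let the level of a dyadic rational [x] be the
    least [n] with [x * 2 ^ n] an integer, the level of other reals being 0,
    and consider for each [n] the equation stating that [f] has the same
    difference as the level function for the step [2 ^ -n].  A solution
    satisfies [f (2 ^ -n) = f 0 + n] for all [n], hence is unbounded
    ([level_system_unsolvable]).  For the equations with [n <= N], however,
    one can modify the level function on each coset of the subgroup
    [2 ^ -N * Z] by a constant.  Off the subgroup the level function is
    constant on cosets, as translation by [2 ^ -N] does not change the level
    ([level_translate]), so it can be replaced by 0 there; on the subgroup it
    is at most [N] ([finite_level_system]). *)

Set Implicit Arguments.
Unset Strict Implicit.
Unset Printing Implicit Defensive.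

Local Open Scope classical_set_scope.
Local Open Scope ring_scope.

(** * Cardinals below a countable one and below omega_1 *)

(** A countable set embeds in [omega1], as an infinite set contains a copy of
    the natural numbers; it is not equinumerous to it since [omega1] is
    uncountable. *)
Lemma card_lt_omega1 (T : Type) (A : set T) : countable A -> card_lt A omega1.
Proof.
have [unc _] := omega1P => cA.
split; last by move=> /eq_countable cE; apply: unc; rewrite -cE.
have /infiniteP : infinite_set omega1 by move=> /finite_set_countable.
exact: card_le_trans.
Qed.

(** An infinite subset of a countable set would be equinumerous to it, by
    Cantor-Bernstein. *)
Lemma finite_of_card_lt_countable (T U : Type) (A : set T) (L : set U) :
  countable L -> card_lt A L -> finite_set A.
Proof.
move=> cL [le neq]; apply: contrapT => /infiniteP natA; apply: neq.
by rewrite card_eq_le le (card_le_trans cL natA).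
Qed.

Lemma finite_subset_range (T : Type) (e : nat -> T) (A : set T) :
  finite_set A -> A `<=` range e ->
  exists N, forall x, A x -> exists2 n, (n <= N)%N & e n = x.
Proof.
move=> finA Ae.
pose idx x := xget 0%N [set n | e n = x].
have idxK x : A x -> e (idx x) = x.
  by move=> /Ae[n _ en]; exact: (@xgetI _ 0%N [set n | e n = x] n).
have /finite_seqP[s sE] := finite_image idx finA.
exists (\max_(n <- s) n)%N => x Ax; exists (idx x); last exact: idxK.
apply: leq_bigmax_seq => //.
by have : [set` s] (idx x) by rewrite -sE; exists x.
Qed.

(** * Compactness of the solution sets *)

Section BoundedFunctions.
Variable R : realType.
Implicit Types (f : R -> R) (S : set (((R -> R) -> (R -> R)) * (R -> R))).

Lemma bounded_funP f : bounded_fun f <-> exists M : R, forall x, `|f x| <= M.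
Proof.
have proper : ProperFilter (globally [set: R]).
  exact: (@globally_properfilter _ _ 0).
split=> [/(ex_bound f)[M fM]|[M fM]].
  by exists M => x; exact: fM.
by apply/(ex_bound f); exists M => x _; exact: fM.
Qed.

Lemma sub_solution S S' f : S' `<=` S -> is_solution S f -> is_solution S' f.
Proof. by move=> sub sol D g /sub; exact: sol. Qed.

(** Bad subsystems for all [N] can be glued together because a countable union
    of countable sets is countable; this is the only place where finite
    subsystems would not do. *)
Lemma uniform_bound S :
  (forall S', S' `<=` S -> countable S' ->
    has_solution_in (bounded_fun : set (R -> R)) S') ->
  exists N : nat, forall S', S' `<=` S -> countable S' ->
    exists2 f, (forall x, `|f x| <= N%:R) & is_solution S' f.
Proof.
move=> solv; apply: contrapT => nob.
have /choice[bad badP] : forall N : nat, exists S',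
    [/\ S' `<=` S, countable S' & ~ exists2 f, (forall x, `|f x| <= N%:R) & is_solution S' f].
  move=> N; apply: contrapT => no; apply: nob; exists N => S' S'S cS'.
  by apply: contrapT => nof; apply: no; exists S'.
have [||f /bounded_funP[M fM] fsol] := solv (\bigcup_N bad N).
- by move=> e [N _]; have [+ _ _] := badP N; exact.
- by apply: bigcup_countable => // N _; have [] := badP N.
have [_ _] := badP (Num.trunc M).+1; apply; exists f => [x|].
  exact: le_trans (fM x) (ltW (truncnS_gt M)).
by apply: sub_solution fsol; exact: bigcup_sup.
Qed.

Lemma continuous_sum (T : topologicalType) (I : Type) (s : seq I)
    (F : I -> T -> R) :
  (forall i, continuous (F i)) -> continuous (fun t => \sum_(i <- s) F i t).
Proof.
move=> Fcont t; elim: s => [|i s IHs].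
  by under eq_fun do rewrite big_nil; exact: cst_continuous.
under eq_fun do rewrite big_cons.
by apply: continuousD; [exact: Fcont|].
Qed.

Lemma continuous_scale (T : topologicalType) (c : R) (F : T -> R) :
  continuous F -> continuous (fun t => c * F t).
Proof.
by move=> Fcont t; apply: continuousM; [exact: cst_continuous|exact: Fcont].
Qed.

Lemma difference_operator_continuous (n : nat) (a b : 'I_n -> R) (x : R) :
  continuous (fun f : prod_topology (fun _ : R => R) =>
    \sum_(i < n) a i * f (x + b i)).
Proof.
apply: continuous_sum => i; apply: continuous_scale.
exact: (@proj_continuous R (fun=> R) (x + b i)).
Qed.

(** Stated in the topology of pointwise convergence, which is what makes the
    box of functions bounded by a constant compact. *)
Lemma equation_closed D (g : R -> R) : is_difference_operator D ->
  closed [set f : prod_topology (fun _ : R => R) | D f = g].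
Proof.
move=> [n [a [b DE]]].
have -> : [set f | D f = g] =
    \bigcap_(x in setT) [set f | \sum_(i < n) a i * f (x + b i) = g x].
  apply/seteqP; split=> f /=; first by move=> <- x _; rewrite /= DE.
  by move=> fE; apply/funext => x; rewrite DE; exact: fE.
apply: closed_bigI => x _.
apply: (@preimage_closed _ _ _ [set y | y = g x]); last exact: closed_eq.
by move=> f _; exact: difference_operator_continuous.
Qed.

(** For functions with a prescribed bound, solvability is a finitary property:
    the solutions of the finite subsystems generate a filter on a compact box,
    and any of its cluster points lies in every closed set of that filter. *)
Lemma compactness S (M : R) : is_difference_system S ->
  (forall S', S' `<=` S -> finite_set S' ->
    exists2 f, (forall x, `|f x| <= M) & is_solution S' f) ->
  exists2 f, (forall x, `|f x| <= M) & is_solution S f.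
Proof.
move=> Sdiff solv.
pose box : set (prod_topology (fun _ : R => R)) :=
  [set f | forall x, [set` `[- M, M]] (f x)].
have boxP f : box f <-> forall x, `|f x| <= M.
  by split=> fM x; have := fM x; rewrite /= in_itv/= -ler_norml.
have box_compact : compact box.
  exact: (@tychonoff _ (fun=> R) _ (fun=> @segment_compact R (- M) M)).
pose sub : set (set _) := [set S' | S' `<=` S /\ finite_set S'].
pose B S' : set (prod_topology (fun _ : R => R)) :=
  [set f | box f /\ is_solution S' f].
have Bfilter : ProperFilter (filter_from sub B).
  apply: filter_from_proper => [|S' [S'S finS']]; last first.
    by have [f /boxP fM fsol] := solv S' S'S finS'; exists f.
  apply: filter_from_filter => [|S1 S2 [S1S fin1] [S2S fin2]].
    by exists set0; split=> //; exact: finite_set0.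
  exists (S1 `|` S2).
    by split; [rewrite subUset|rewrite finite_setU].
  move=> f [fbox fsol]; split; split=> //; apply: sub_solution fsol.
    exact: subsetUl.
  exact: subsetUr.
have [|f [/boxP fM fcl]] := box_compact _ Bfilter.
  by exists set0 => [|f []//]; split=> //; exact: finite_set0.
exists f => // D g SDg; apply: (equation_closed (g := g) (Sdiff _ _ SDg)).
move=> V fV; apply: fcl => //; exists [set (D, g)].
  by split=> [_ ->//|]; exact: finite_set1.
by move=> h [_ hsol]; exact: hsol.
Qed.

(** * The level of a dyadic rational *)

Definition dyadic (n : nat) (x : R) : bool := x * 2 ^+ n \is a Num.int.

Lemma dyadicB n x y : dyadic n x -> dyadic n y -> dyadic n (x - y).
Proof. by rewrite /dyadic mulrBl; exact: rpredB. Qed.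

Lemma dyadicD n x y : dyadic n x -> dyadic n y -> dyadic n (x + y).
Proof. by rewrite /dyadic mulrDl; exact: rpredD. Qed.

Lemma dyadic_le m n x : (m <= n)%N -> dyadic m x -> dyadic n x.
Proof.
move=> mn mx; rewrite /dyadic -(subnK mn) addnC exprD mulrA.
by rewrite rpredM// rpredX// natr_int.
Qed.

Lemma dyadic_expN n : dyadic n (2 ^- n).
Proof. by rewrite /dyadic mulVf ?rpred1// expf_neq0// pnatr_eq0. Qed.

Lemma dyadic_expN_le m n : dyadic m (2 ^- n) -> (n <= m)%N.
Proof.
have pos k : 0 < (2 : R) ^+ k by rewrite exprn_gt0.
move=> /norm_intr_ge1; rewrite mulf_neq0 ?invr_eq0 ?gt_eqF// => /(_ isT).
rewrite ger0_norm; last by rewrite mulr_ge0 ?invr_ge0 ?(ltW (pos _)).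
by rewrite mulrC ler_pdivlMr// mul1r ler_eXn2l// ltr1n.
Qed.

(** The junk value 0 makes [level] vanish off the dyadic rationals. *)
Definition least (P : pred nat) : nat :=
  if pselect (exists n, P n) is left ex then ex_minn ex else 0%N.

Lemma leastP (P : pred nat) n : P n -> P (least P) /\ (least P <= n)%N.
Proof.
rewrite /least => Pn; case: pselect => [ex|[]]; last by exists n.
by case: ex_minnP => m Pm /(_ n Pn).
Qed.

Definition level (x : R) : nat := least (fun n => dyadic n x).

Lemma level_le n x : dyadic n x -> (level x <= n)%N.
Proof. by move=> /(@leastP (fun n => dyadic n x))[]. Qed.

Lemma level_expN n : level (2 ^- n) = n.
Proof.
have [dy le] := @leastP (fun m => dyadic m (2 ^- n)) _ (dyadic_expN n).
by apply/eqP; rewrite eqn_leq le; exact: dyadic_expN_le.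
Qed.

(** The subgroups [2 ^ -n * Z] increase with [n], so [x] lies in none of those
    with [n <= N], and the others contain [h]; hence exactly the same subgroups
    contain [x] and [x + h]. *)
Lemma level_translate N x h :
  dyadic N h -> ~~ dyadic N x -> level (x + h) = level x.
Proof.
move=> Nh Nx; have Nxh : ~~ dyadic N (x + h).
  by apply: contra Nx => /dyadicB/(_ Nh); rewrite addrK.
congr least; apply/funext => n; have [nN|/ltnW Nn] := leqP n N.
  by rewrite (contraNF (dyadic_le nN) Nx) (contraNF (dyadic_le nN) Nxh).
have nh := dyadic_le Nn Nh; apply/idP/idP => [/dyadicB/(_ nh)|/dyadicD].
  by rewrite addrK.
exact.
Qed.

(** * An unsolvable system with solvable finite subsystems *)

Definition difference (h : R) (f : R -> R) (x : R) : R := f (x + h) - f x.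

Lemma difference_is_operator h : is_difference_operator (difference h).
Proof.
exists 2%N, (fun i => if i == ord0 then 1 else -1),
  (fun i => if i == ord0 then h else 0) => f x.
by rewrite big_ord_recl big_ord1/= mul1r mulN1r addr0.
Qed.

Definition level_equation (n : nat) :
    ((R -> R) -> (R -> R)) * (R -> R) :=
  (difference (2 ^- n), difference (2 ^- n) (fun x => (level x)%:R)).

(** Cutting the level function off outside [2 ^ -N * Z] bounds it by [N] and
    preserves its differences for all steps in that subgroup. *)
Lemma finite_level_system S : S `<=` range level_equation -> finite_set S ->
  has_solution_in (bounded_fun : set (R -> R)) S.
Proof.
move=> Srange finS; have [N SN] := finite_subset_range finS Srange.
exists (fun x => if dyadic N x then (level x)%:R else 0).
  apply/bounded_funP; exists N%:R => x; case: ifP => [xN|_].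
    by rewrite normr_nat ler_nat level_le.
  by rewrite normr0.
move=> D g /SN[n nN [<- <-]]; apply/funext => x; rewrite /difference.
have nh := dyadic_le nN (dyadic_expN n).
case: (boolP (dyadic N x)) => xN; first by rewrite dyadicD.
rewrite (level_translate nh xN) !subrr ifN ?subrr//.
by apply: contra xN => /dyadicB/(_ nh); rewrite addrK.
Qed.

(** Evaluated at 0, the equations force [f (2 ^ -n)] to grow like [n]. *)
Lemma level_system_unsolvable :
  ~ has_solution_in (bounded_fun : set (R -> R)) (range level_equation).
Proof.
move=> [f /bounded_funP[M fM] fsol].
(* [n - level 0] then exceeds [2 * M], the oscillation allowed to [f]. *)
pose n := (Num.trunc (M + M + (level 0)%:R)).+1.
have : f (2 ^- n) - f 0 = n%:R - (level 0)%:R.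
  have /(congr1 (@^~ 0)) := fsol _ _ (imageT level_equation n).
  by rewrite /difference add0r level_expN.
apply/eqP; rewrite lt_eqF//.
apply: (@le_lt_trans _ _ (M + M)).
  apply: le_trans (ler_norm _) _; apply: le_trans (ler_normB _ _) _.
  exact: lerD.
by rewrite ltrBrDr; exact: truncnS_gt.
Qed.

End BoundedFunctions.

Theorem theorem3p3 (R : realType) :
  is_solvability_cardinal (bounded_fun : set (R -> R)) omega1.
Proof.
split=> [S Sdiff solv|U L solv].
  have [S' S'S cS'|N solvN] := @uniform_bound R S.
    by apply: solv => //; exact: card_lt_omega1.
  have [f fN fsol] := compactness Sdiff (fun S' S'S finS' =>
    solvN S' S'S (finite_set_countable finS')).
  by exists f => //; apply/bounded_funP; exists N%:R.
apply: omega1P.2 => cL; apply: (@level_system_unsolvable R); apply: solv.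
  by move=> D g [n _ [<- _]]; exact: difference_is_operator.
move=> S' S'S lt; apply: finite_level_system => //.
exact: finite_of_card_lt_countable cL lt.
Qed.
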